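(* Let $N$ be the communication network with nodes $1,\dots,11$; directed edges $1\to4,\ 1\to5,\ 1\to6,\ 2\to4,\ 2\to5,\ 2\to7,\ 3\to4,\ 3\to6,\ 3\to7,\ 4\to8,\ 4\to9,\ 4\to10,\ 5\to8,\ 5\to11,\ 6\to9,\ 6\to11,\ 7\to10,\ 7\to11$; sender nodes $1,2,3$ with messages $a,b,c$ respectively; and receiver nodes $8,9,10,11$, where node $8$ requires $c$, node $9$ requires $b$, node $10$ requires $a$, and node $11$ requires $c$. Then $N$ is (linearly) solvable over every ring $R$ in which the element $1+1$ is invertible, and $N$ is not (linearly) solvable over any Dedekind finite ring $R$ in which $1+1$ is not invertible.
   Context: Rings are associative with $1$, not necessarily commutative. A ring $R$ is Dedekind finite if $\forall x,y\in R\ (xy=1\rightarrow yx=1)$. Messages are elements of a faithful left $R$-module $M$. A linear assignment over $R$ gives each edge $u\to v$ an element $r_{v,u}\in R$; each non-sender node $v$ carries the message $m_v=\sum_{u\to v} r_{v,u}m_u$. A network is (linearly) solvable over $R$ if there is an assignment for which every receiver node carries exactly its required message, for all choices of sender messages. Equivalently (since $M$ is faithful): for each sender $s$ and each receiver $t$, the sum over all directed paths $s=v_0\to v_1\to\dots\to v_l=t$ of the products $r_{v_l,v_{l-1}}\cdots r_{v_2,v_1}r_{v_1,v_0}$ equals $1$ if $t$ requires the message of $s$, and equals $0$ otherwise. *)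

(* Defs.v *)
From mathcomp Require Import all_boot all_algebra.
Set Implicit Arguments.
Unset Strict Implicit.
Unset Printing Implicit Defensive.
Import GRing.Theory.
Local Open Scope ring_scope.

Definition dedekind_finite (R : pzRingType) : Prop :=
  forall x y : R, x * y = 1 -> y * x = 1.

(* [GRing.unit] would require a [unitRingType], in particular a nonzero ring
   with a chosen inverse function. *)
Definition invertible (R : pzRingType) (x : R) : Prop :=
  exists y : R, x * y = 1 /\ y * x = 1.

Definition faithful (R : pzRingType) (M : lmodType R) : Prop :=
  forall r : R, (forall x : M, r *: x = 0) -> r = 0.

(* [demand t s]: the node t is a receiver and requires the message of s. *)
Record network := Network {
  node :> finType;
  edge : rel node;
  sender : pred node;
  demand : rel node;
  edge_acyclic : forall u v, edge u v -> ~~ connect edge v u;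
  demand_sender : forall t s, demand t s -> sender s
}.

(* The coefficient of the edge u -> v is [r v u]; values of r at pairs that are
   not edges play no role. *)
Definition carries (N : network) (R : pzRingType) (M : lmodType R)
    (r : N -> N -> R) (m : N -> M) : Prop :=
  forall v : N, ~~ sender v -> m v = \sum_(u | edge u v) r v u *: m u.

(* Since the network is acyclic, every choice of the sender messages extends to
   exactly one m with [carries r m]: quantifying over these m amounts to
   quantifying over all choices of sender messages. *)
Definition linearly_solvable (N : network) (R : pzRingType) (M : lmodType R) :
    Prop :=
  exists r : N -> N -> R, forall m : N -> M, carries r m ->
    forall t s : N, demand t s -> m t = m s.

Definition V1_edges : seq (nat * nat) :=
  [:: (1, 4); (1, 5); (1, 6); (2, 4); (2, 5); (2, 7); (3, 4); (3, 6); (3, 7);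
      (4, 8); (4, 9); (4, 10); (5, 8); (5, 11); (6, 9); (6, 11);
      (7, 10); (7, 11)]%N.

(* Pairs (receiver, sender whose message it requires); the nodes 1, 2, 3 send
   a, b, c. *)
Definition V1_demands : seq (nat * nat) :=
  [:: (8, 3); (9, 2); (10, 1); (11, 3)]%N.

(* The node labelled k (1 <= k <= 11) is the element k - 1 of 'I_11. *)
Definition V1_edge : rel 'I_11 := fun u v => (u.+1, v.+1) \in V1_edges.
Definition V1_sender : pred 'I_11 := fun u => u.+1 \in [:: 1; 2; 3]%N.
Definition V1_demand : rel 'I_11 := fun t s => (t.+1, s.+1) \in V1_demands.

Lemma V1_edge_ltn u v : V1_edge u v -> (u < v)%N.
Proof.
have /allP lt_edges : all (fun e => e.1 < e.2)%N V1_edges by [].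
by move/lt_edges.
Qed.

Lemma V1_edge_acyclic u v : V1_edge u v -> ~~ connect V1_edge v u.
Proof.
move=> /V1_edge_ltn lt_uv; apply/negP => /connectP[p].
suff le_last : forall x, path V1_edge x p -> (x <= last x p)%N.
  by move=> /le_last le_vu u_last; rewrite -u_last leqNgt lt_uv in le_vu.
elim: p => //= y p IHp x /andP[/V1_edge_ltn/ltnW le_xy /IHp].
exact: leq_trans.
Qed.

Lemma V1_demand_sender t s : V1_demand t s -> V1_sender s.
Proof.
have /allP sub_demands : all (fun e => e.2 \in [:: 1; 2; 3]%N) V1_demands by [].
by move/sub_demands.
Qed.

Definition V1_network : network := Network V1_edge_acyclic V1_demand_sender.

(* Main.v *)
(** Over a Dedekind finite ring the demands of nodes 8, 9, 10 force the three
coefficients α, β, γ of the message at node 4 to be units, and force the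
messages at nodes 5, 6, 7 to be left multiples d(αa + βb), e(αa + γc),
z(βb + γc) of the corresponding parts of it. If node 11 combines these with
coefficients t5, t6, t7, its demand reads t5 d + t6 e = t5 d + t7 z = 0 and
(t6 e + t7 z) γ = 1, so (1 + 1)(- t5 d γ) = 1. Conversely, with all edge
coefficients into nodes 4 to 7 equal to 1 and h the inverse of 1 + 1, the
receivers recover c, b, a as differences of two messages and c as
h(m6 + m7 - m5). *)

Require Import Defs.
From mathcomp Require Import all_boot all_algebra.
Set Implicit Arguments.
Unset Strict Implicit.
Import GRing.Theory.
Local Open Scope ring_scope.

Lemma faithful_inj (R : pzRingType) (M : lmodType R) (r s : R) :
  faithful M -> (forall x : M, r *: x = s *: x) -> r = s.
Proof.
move=> faithfulM eq_rs; apply/eqP; rewrite -subr_eq0; apply/eqP/faithfulM => x.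
by rewrite scalerBl eq_rs subrr.
Qed.

(** Setting two of the three messages to 0 isolates one pair of coefficients. *)
Lemma faithful_coef3 (R : pzRingType) (M : lmodType R)
    (x y z x' y' z' : R) :
  faithful M ->
  (forall a b c : M,
     x *: a + y *: b + z *: c = x' *: a + y' *: b + z' *: c) ->
  [/\ x = x', y = y' & z = z'].
Proof.
move=> faithfulM eqM; split; apply: (@faithful_inj _ M) => // u.
- by have := eqM u 0 0; rewrite !scaler0 !addr0.
- by have := eqM 0 u 0; rewrite !scaler0 !addr0 !add0r.
- by have := eqM 0 0 u; rewrite !scaler0 !add0r.
Qed.

(** As [z] inverts [p] on both sides, [q * u = - (p * x)] gives [- (s * z * q) * u = 1]. Dedekind
    finiteness swaps the factors, so [q] has the left inverse [- (u * s * z)]; cancelling [q] in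
    [q * v = - (p * y)] leaves [v = u * s * y]. *)
Lemma dedekind_finite_proportional (R : pzRingType) (p q s x y z u v : R) :
    dedekind_finite R ->
    p * z = 1 -> s * x = 1 -> p * x + q * u = 0 -> p * y + q * v = 0 ->
  exists d, u = d * x /\ v = d * y.
Proof.
move=> finR pz sx /(canRL (addKr _)); rewrite addr0 => qu.
move/(canRL (addKr _)); rewrite addr0 => qv.
have zp := finR _ _ pz.
have wq : (- (u * s * z)) * q = 1.
  rewrite mulNr -!mulrA -mulrN; apply: finR.
  by rewrite mulNr -!mulrA qu !mulrN opprK (mulrA z) zp mul1r.
exists (u * s); split; first by rewrite -mulrA sx mulr1.
rewrite -[LHS]mul1r -wq -[LHS]mulrA qv mulrN mulNr opprK -!mulrA.
by rewrite (mulrA z) zp mul1r.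
Qed.

(** The sum over the concrete edge list computes. For each target the list has its sources in
    increasing order, so both sides reduce to the same expression at each of the eleven nodes. *)
Lemma V1_sum_edges (V : nmodType) (F : nat -> V) (v : 'I_11) :
  \sum_(u | V1_edge u v) F u.+1 = \sum_(e <- V1_edges | e.2 == v.+1) F e.1.
Proof.
rewrite -(big_mkord (fun u => (u.+1, v.+1)%N \in V1_edges) (fun u => F u.+1)).
case: v => v /= lt_v.
by do 11?[case: v lt_v => [|v] lt_v; first by rewrite unlock].
Qed.

(* Coefficients and messages are indexed here by the labels 1, ..., 11. *)
Definition V1_equations (R : pzRingType) (M : lmodType R)
    (r : nat -> nat -> R) (m : nat -> M) : Prop :=
  [/\ m 4%N = r 4%N 1%N *: m 1%N + r 4%N 2%N *: m 2%N + r 4%N 3%N *: m 3%N,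
      m 5%N = r 5%N 1%N *: m 1%N + r 5%N 2%N *: m 2%N,
      m 6%N = r 6%N 1%N *: m 1%N + r 6%N 3%N *: m 3%N &
      m 7%N = r 7%N 2%N *: m 2%N + r 7%N 3%N *: m 3%N] /\
  [/\ m 8%N = r 8%N 4%N *: m 4%N + r 8%N 5%N *: m 5%N,
      m 9%N = r 9%N 4%N *: m 4%N + r 9%N 6%N *: m 6%N,
      m 10%N = r 10%N 4%N *: m 4%N + r 10%N 7%N *: m 7%N &
      m 11%N = r 11%N 5%N *: m 5%N + r 11%N 6%N *: m 6%N + r 11%N 7%N *: m 7%N].

Lemma V1_carriesP (R : pzRingType) (M : lmodType R)
    (r : nat -> nat -> R) (m : nat -> M) :
  carries (N := V1_network) (fun v u : 'I_11 => r v.+1 u.+1)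
    (fun v : 'I_11 => m v.+1) <-> V1_equations r m.
Proof.
have sumE (v : 'I_11) : \sum_(u | V1_edge u v) r v.+1 u.+1 *: m u.+1 =
    \sum_(e <- V1_edges | e.2 == v.+1) r v.+1 e.1 *: m e.1.
  exact: (V1_sum_edges (fun k => r v.+1 k *: m k)).
split=> [carr | [[m4 m5 m6 m7] [m8 m9 m10 m11]] v].
- have eqm k (lt_k : (k < 11)%N) : (3 <= k)%N ->
      m k.+1 = \sum_(e <- V1_edges | e.2 == k.+1) r k.+1 e.1 *: m e.1.
    move=> ge3; rewrite -(sumE (Ordinal lt_k)); apply: (carr (Ordinal lt_k)).
    by case: k lt_k ge3 => [|[|[|k]]].
  by split; split; rewrite [LHS]eqm // unlock /= !addr0 ?addrA.
- rewrite [RHS]sumE; case: v => v lt_v /=.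
  by do 11?[case: v lt_v => [|v] lt_v;
    first by rewrite // unlock /= !addr0 ?addrA].
Qed.

Lemma V1_solvable_of_2_invertible (R : pzRingType) (M : lmodType R) :
  invertible (1 + 1 : R) -> linearly_solvable V1_network M.
Proof.
case=> h [_ h2].
(* Nodes 8, 9, 10 subtract what 5, 6, 7 send from what 4 sends. *)
pose r (v u : nat) : R :=
  if v == 11%N then if u == 5%N then - h else h
  else if (8 <= v)%N && (u != 4%N) then - 1 else 1.
exists (fun v u : 'I_11 => r v.+1 u.+1) => m0 carr t s dem.
pose m k := m0 (inord k.-1).
have mE (v : 'I_11) : m0 v = m v.+1 by rewrite /m inord_val.
have /V1_carriesP : carries (N := V1_network)
    (fun v u : 'I_11 => r v.+1 u.+1) (fun v : 'I_11 => m v.+1).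
  by move=> v /carr; rewrite -mE => ->; apply: eq_bigr => u _; rewrite mE.
rewrite /V1_equations /r /= !scale1r !scaleNr !scale1r.
case=> [[m4 m5 m6 m7] [m8 m9 m10 m11]].
have [{}m8 {}m9 {}m10 {}m11] :
    [/\ m 8%N = m 3%N, m 9%N = m 2%N, m 10%N = m 1%N & m 11%N = m 3%N].
  split.
  - by rewrite m8 m4 m5 addrC addKr.
  - by rewrite m9 m4 m6 (addrAC (m 1%N)) addrC addrK.
  - by rewrite m10 m4 m7 -(addrA (m 1%N)) addrK.
  - rewrite m11 -scalerN -!scalerDr -addrA.
    (* The sum of a + c and b + c exceeds a + b by twice c, which [h] halves. *)
    have -> : m 6%N + m 7%N = m 5%N + (m 3%N + m 3%N).
      by rewrite m5 m6 m7 addrACA.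
    by rewrite addKr -[m 3%N]scale1r -scalerDl scalerA h2 scale1r.
rewrite !mE; move: dem; rewrite /= /V1_demand !inE => /or4P[] /eqP[-> ->] //.
Qed.

Lemma V1_2_invertible_of_solvable (R : pzRingType) (M : lmodType R) :
  faithful M -> dedekind_finite R -> linearly_solvable V1_network M ->
  invertible (1 + 1 : R).
Proof.
move=> faithfulM finR [r0 sol].
pose r (v u : nat) : R := r0 (inord v.-1) (inord u.-1).
have rE (v u : 'I_11) : r0 v u = r v.+1 u.+1 by rewrite /r !inord_val.
have dem (a b c : M) :
    let m4 := r 4%N 1%N *: a + r 4%N 2%N *: b + r 4%N 3%N *: c in
    let m5 := r 5%N 1%N *: a + r 5%N 2%N *: b in
    let m6 := r 6%N 1%N *: a + r 6%N 3%N *: c in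
    let m7 := r 7%N 2%N *: b + r 7%N 3%N *: c in
    [/\ r 8%N 4%N *: m4 + r 8%N 5%N *: m5 = c,
        r 9%N 4%N *: m4 + r 9%N 6%N *: m6 = b,
        r 10%N 4%N *: m4 + r 10%N 7%N *: m7 = a &
        r 11%N 5%N *: m5 + r 11%N 6%N *: m6 + r 11%N 7%N *: m7 = c].
  move=> m4 m5 m6 m7.
  (* Propagating [a], [b], [c] along the edges; the leading 0 aligns positions with labels. *)
  pose m := nth 0 [:: 0; a; b; c; m4; m5; m6; m7;
    r 8%N 4%N *: m4 + r 8%N 5%N *: m5;
    r 9%N 4%N *: m4 + r 9%N 6%N *: m6; r 10%N 4%N *: m4 + r 10%N 7%N *: m7;
    r 11%N 5%N *: m5 + r 11%N 6%N *: m6 + r 11%N 7%N *: m7].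
  have carr : carries (N := V1_network) r0 (fun v : 'I_11 => m v.+1).
    have /V1_carriesP carr_r : V1_equations r m by [].
    by move=> v /carr_r ->; apply: eq_bigr => u _; rewrite rE.
  have solE k l (lt_k : (k < 11)%N) (lt_l : (l < 11)%N) :
      (k.+1, l.+1) \in V1_demands -> m k.+1 = m l.+1.
    exact: (sol _ carr (Ordinal lt_k) (Ordinal lt_l)).
  (* The arguments of [solE] are ordinals, one below the labels. *)
  by split; [exact: (solE 7 2) | exact: (solE 8 1)
            | exact: (solE 9 0) | exact: (solE 10 2)].
have [p1 p2 p3] : [/\ r 8%N 4%N * r 4%N 1%N + r 8%N 5%N * r 5%N 1%N = 0,
    r 8%N 4%N * r 4%N 2%N + r 8%N 5%N * r 5%N 2%N = 0 &
    r 8%N 4%N * r 4%N 3%N = 1].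
  apply: (@faithful_coef3 _ M) => // a b c; have [+ _ _ _] := dem a b c.
  rewrite !scale0r !add0r scale1r => {2}<-.
  by rewrite !scalerDr !scalerDl !scalerA [RHS]addrAC addrACA.
have [q1 q2 q3] : [/\ r 9%N 4%N * r 4%N 1%N + r 9%N 6%N * r 6%N 1%N = 0,
    r 9%N 4%N * r 4%N 2%N = 1 &
    r 9%N 4%N * r 4%N 3%N + r 9%N 6%N * r 6%N 3%N = 0].
  apply: (@faithful_coef3 _ M) => // a b c; have [_ + _ _] := dem a b c.
  rewrite !scale0r add0r addr0 scale1r => {2}<-.
  rewrite !scalerDr !scalerDl !scalerA [RHS]addrACA.
  by congr (_ + _); rewrite addrAC.
have [s1 s2 s3] : [/\ r 10%N 4%N * r 4%N 1%N = 1,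
    r 10%N 4%N * r 4%N 2%N + r 10%N 7%N * r 7%N 2%N = 0 &
    r 10%N 4%N * r 4%N 3%N + r 10%N 7%N * r 7%N 3%N = 0].
  apply: (@faithful_coef3 _ M) => // a b c; have [_ _ + _] := dem a b c.
  rewrite !scale0r !addr0 scale1r => {2}<-.
  rewrite !scalerDr !scalerDl !scalerA -!addrA; congr (_ + _).
  by rewrite !addrA; congr (_ + _); rewrite addrAC.
have [t1 t2 t3] : [/\ r 11%N 5%N * r 5%N 1%N + r 11%N 6%N * r 6%N 1%N = 0,
    r 11%N 5%N * r 5%N 2%N + r 11%N 7%N * r 7%N 2%N = 0 &
    r 11%N 6%N * r 6%N 3%N + r 11%N 7%N * r 7%N 3%N = 1].
  apply: (@faithful_coef3 _ M) => // a b c; have [_ _ _ +] := dem a b c.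
  rewrite !scale0r !add0r scale1r => {2}<-.
  rewrite !scalerDr !scalerDl !scalerA [X in _ = X + _]addrACA.
  by rewrite -[RHS]addrA [X in _ = _ + X]addrACA [RHS]addrA.
(* Each use takes the vanishing coefficients at one of the receivers 8, 9, 10, and a left inverse of
   α or β from the demand of another. *)
have [d [d1 d2]] := dedekind_finite_proportional finR p3 s1 p1 p2.
have [e [e1 e3]] := dedekind_finite_proportional finR q2 s1 q1 q3.
have [z [z2 z3]] := dedekind_finite_proportional finR s1 q2 s2 s3.
have te : r 11%N 6%N * e = - (r 11%N 5%N * d).
  apply/eqP; rewrite -addr_eq0 addrC; apply/eqP.
  rewrite d1 e1 !mulrA -mulrDl in t1.
  (* Cancelling α on the right needs a right inverse: by Dedekind finiteness, its left inverse from
     [s1] is one. *)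
  by rewrite -[LHS]mulr1 -(finR _ _ s1) mulrA t1 mul0r.
have tz : r 11%N 7%N * z = - (r 11%N 5%N * d).
  apply/eqP; rewrite -addr_eq0 addrC; apply/eqP.
  rewrite d2 z2 !mulrA -mulrDl in t2.
  by rewrite -[LHS]mulr1 -(finR _ _ q2) mulrA t2 mul0r.
rewrite e3 z3 !mulrA te tz in t3.
(* Multiplying by [1 + 1] on either side doubles this element, and [t3] says that its double is
   1. *)
exists (- (r 11%N 5%N * d) * r 4%N 3%N).
by rewrite mulrDl mulrDr mul1r mulr1 t3.
Qed.

Theorem theoremV1 (R : pzRingType) (M : lmodType R) (faithfulM : faithful M) :
  (invertible (1 + 1 : R) -> linearly_solvable V1_network M) /\
  (dedekind_finite R -> ~ invertible (1 + 1 : R) ->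
     ~ linearly_solvable V1_network M).
Proof.
split=> [|finR not_inv2 solvable]; first exact: V1_solvable_of_2_invertible.
exact/not_inv2/(V1_2_invertible_of_solvable faithfulM finR solvable).
Qed.
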